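(* Let $\eta\in(0,1/2)$, let $d>2^{1/\eta}$ be an integer, and let $\gamma\in\bigl(0,\eta-\frac{\log2}{\log d}\bigr]$. Let $N\ge1$ be an integer, $\mathbf c=(N/2,\dots,N/2)$, and let $\mathbf a\in\mathcal W(d,N)$ with $\operatorname{dist}_d(\mathbf a,\mathbf c)\ge d^{\gamma-\eta}$. Then $$\frac{1}{\#\mathcal V}\#\bigl\{\mathbf v\in\mathcal V:|\cos\theta_{\mathbf v}|\le(\sqrt2+1)d^{-\gamma}\bigr\}\ge1-\frac{1}{d^{1-2\eta}},$$ where for $\mathbf v\in\mathcal V$, $\theta_{\mathbf v}$ is the angle at $\mathbf c$ between the segments from $\mathbf c$ to $\mathbf a$ and from $\mathbf c$ to $\mathbf v$.
   Context: $\mathcal W(d,N)=\{0,1,\dots,N\}^d$, $\mathcal V=\{0,N\}^d$ (vertices of $[0,N]^d$). $\operatorname{dist}_d(\mathbf u,\mathbf v)=\frac{1}{\sqrt d\,N}\bigl(\sum_j(u_j-v_j)^2\bigr)^{1/2}$. *)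

(* Defs.v *)
From HB Require Import structures.
From mathcomp Require Import all_boot all_order all_algebra.
From mathcomp Require Import reals exp trigo.

Set Implicit Arguments.
Unset Strict Implicit.
Unset Printing Implicit Defensive.

Import Order.TTheory GRing.Theory Num.Theory.
Local Open Scope ring_scope.

Definition W (d N : nat) : finType := 'rV['I_N.+1]_d.

Definition V (d N : nat) : {set W d N} :=
  [set v : W d N | [forall j, (v ord0 j == 0%N :> nat) || (v ord0 j == N :> nat)]].

Definition pt (R : realType) (d N : nat) (u : W d N) : 'rV[R]_d :=
  \row_j (u ord0 j : nat)%:R.

Definition center (R : realType) (d N : nat) : 'rV[R]_d :=
  const_mx (N%:R / 2).

Definition dot (R : realType) (d : nat) (u v : 'rV[R]_d) : R :=
  \sum_j u ord0 j * v ord0 j.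

(* The library norm on matrices is the sup norm, hence this definition. *)
Definition enorm (R : realType) (d : nat) (u : 'rV[R]_d) : R :=
  Num.sqrt (\sum_j u ord0 j ^+ 2).

(* Euclidean distance normalized by the diameter of [0, N]^d. *)
Definition ndist (R : realType) (d N : nat) (u v : 'rV[R]_d) : R :=
  (Num.sqrt d%:R * N%:R)^-1 * Num.sqrt (\sum_j (u ord0 j - v ord0 j) ^+ 2).

(* The angle at c, in [0, pi], between the segments from c to a and from c to
   v; meaningful only if a <> c and v <> c. *)
Definition angle (R : realType) (d : nat) (a c v : 'rV[R]_d) : R :=
  acos (dot (a - c) (v - c) / (enorm (a - c) * enorm (v - c))).

(* Main.v *)
(* Every coordinate of [v - c] is [N/2] or [-N/2], and flipping one coordinate
   shows that distinct coordinates are uncorrelated over the vertices. Hence the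
   mean of [<a - c, v - c>^2] is [(N/2)^2 |a - c|^2], that is, the mean of
   [cos^2 theta_v] is at most [1/d]. Chebyshev's inequality at a threshold which
   is at least [d^(-eta)] bounds the proportion of exceptional vertices by
   [d^(2 eta - 1)]. *)
Require Import Defs.
From HB Require Import structures.
From mathcomp Require Import all_boot all_order all_algebra.
From mathcomp Require Import reals exp trigo.
From mathcomp Require Import ring lra zify.

Set Implicit Arguments.
Unset Strict Implicit.
Unset Printing Implicit Defensive.

Import Order.TTheory GRing.Theory Num.Theory.
Local Open Scope ring_scope.

Lemma dot_self_ge0 (R : realType) (d : nat) (u : 'rV[R]_d) : 0 <= dot u u.
Proof. by apply: sumr_ge0 => j _; rewrite -expr2 sqr_ge0. Qed.

Lemma enorm_sqr (R : realType) (d : nat) (u : 'rV[R]_d) :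
  enorm u ^+ 2 = dot u u.
Proof.
by rewrite sqr_sqrtr; [apply: eq_bigr | apply: sumr_ge0 => j _; exact: sqr_ge0].
Qed.

(** Cauchy-Schwarz: the squared norm of [dot v v * u - dot u v * v] is [dot v v] times the
    difference of the two sides, so one can divide by [dot v v] unless [v] vanishes. *)
Lemma dot_sqr_le (R : realType) (d : nat) (u v : 'rV[R]_d) :
  dot u v ^+ 2 <= dot u u * dot v v.
Proof.
have expand (b c : R) : \sum_j (b * u ord0 j - c * v ord0 j) ^+ 2
    = b ^+ 2 * dot u u - 2 * b * c * dot u v + c ^+ 2 * dot v v.
  rewrite /dot !mulr_sumr -sumrB -big_split /=.
  by apply: eq_bigr => j _; ring.
have : 0 <= dot v v * (dot u u * dot v v - dot u v ^+ 2).
  suff <- : \sum_j (dot v v * u ord0 j - dot u v * v ord0 j) ^+ 2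
      = dot v v * (dot u u * dot v v - dot u v ^+ 2).
    by apply: sumr_ge0 => j _; exact: sqr_ge0.
  by rewrite expand; ring.
have [v0 _|v_neq0] := eqVneq (dot v v) 0; last first.
  by rewrite pmulr_rge0 ?subr_ge0 // lt_def v_neq0 dot_self_ge0.
have vj0 j : v ord0 j = 0.
  have /psumr_eq0P : \sum_j v ord0 j * v ord0 j = 0 := v0.
  move=> /(_ (fun j _ => sqr_ge0 (v ord0 j))) /(_ j isT) /eqP.
  by rewrite mulf_eq0 orbb => /eqP.
rewrite v0 mulr0 /dot big1 ?expr0n // => j _.
by rewrite vj0 mulr0.
Qed.

(* Also valid when [a = c] or [v = c]: the quotient is then [0 = cos (acos 0)]. *)
Lemma cos_angle (R : realType) (d : nat) (a c v : 'rV[R]_d) :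
  cos (angle a c v) = dot (a - c) (v - c) / (enorm (a - c) * enorm (v - c)).
Proof.
set x := _ / _; suff x1 : `|x| <= 1.
  by rewrite /angle -/x acosK ?in_itv /= -?ler_norml.
rewrite -(ler_pXn2r (ltn0Sn 1)) ?nnegrE // real_normK ?num_real // expr1n.
rewrite expr_div_n exprMn !enorm_sqr; set B := (X in _ / X).
have B_ge0 : 0 <= B by rewrite mulr_ge0 ?dot_self_ge0.
have [->|B_neq0] := eqVneq B 0; first by rewrite invr0 mulr0.
by rewrite ler_pdivrMr ?mul1r ?dot_sqr_le // lt_def B_neq0.
Qed.

(** Reflection of the grid in the hyperplane $x_i = N/2$: on ['I_N.+1], [rev_ord] sends $k$ to $N -
    k$, and in particular exchanges $0$ and $N$. *)
Definition flip (d N : nat) (i : 'I_d) (v : W d N) : W d N :=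
  \row_j (if j == i then rev_ord (v ord0 j) else v ord0 j).

Lemma flipK (d N : nat) (i : 'I_d) : involutive (@flip d N i).
Proof.
by move=> v; apply/rowP => j; rewrite !mxE; case: eqP => // _; rewrite rev_ordK.
Qed.

Lemma flip_V (d N : nat) (i : 'I_d) (v : W d N) :
  (flip i v \in V d N) = (v \in V d N).
Proof.
rewrite !inE; apply: eq_forallb => j; rewrite mxE; case: ifP => //= _.
have := ltn_ord (v ord0 j); move: (nat_of_ord _) => m; lia.
Qed.

Lemma card_V_gt0 (d N : nat) : (0 < #|V d N|)%N.
Proof.
apply/card_gt0P; exists (const_mx ord0); rewrite inE.
by apply/forallP => j; rewrite mxE.
Qed.

Lemma pt_flip (R : realType) (d N : nat) (i j : 'I_d) (v : W d N) :
  (pt R (flip i v) - center R d N) ord0 j =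
  (-1) ^+ (j == i) * (pt R v - center R d N) ord0 j.
Proof.
rewrite !mxE; case: eqP => [->|_] /=; last by rewrite expr0 mul1r.
by rewrite subSS natrB ?leq_ord // expr1; field.
Qed.

Lemma pt_V_sqr (R : realType) (d N : nat) (v : W d N) (j : 'I_d) :
  v \in V d N -> (pt R v - center R d N) ord0 j ^+ 2 = (N%:R / 2) ^+ 2.
Proof.
rewrite inE => /forallP/(_ j) /orP[] /eqP vj; rewrite !mxE vj; first by ring.
by field.
Qed.

(** Reindexing by [flip i] negates the factor at [i] and keeps the one at [j], so the sum is its own
    opposite. *)
Lemma sum_V_coord (R : realType) (d N : nat) (i j : 'I_d) : i != j ->
  \sum_(v in V d N) (pt R v - center R d N) ord0 i *
                    (pt R v - center R d N) ord0 j = 0.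
Proof.
move=> ij; set S := LHS; suff : S = - S by lra.
rewrite {1}/S (reindex_inj (inv_inj (@flipK d N i))) /= -sumrN.
apply: eq_big => [v|v _]; first exact: flip_V.
by rewrite !pt_flip eqxx eq_sym (negPf ij) expr0 expr1; ring.
Qed.

(** Once the square is expanded into a double sum over coordinates, only the diagonal survives, and
    there each vertex contributes the same $(N/2)^2$. *)
Lemma sum_V_dot_sqr (R : realType) (d N : nat) (w : 'rV[R]_d) :
  \sum_(v in V d N) dot w (pt R v - center R d N) ^+ 2 =
  #|V d N|%:R * ((N%:R / 2) ^+ 2 * dot w w).
Proof.
pose y (v : W d N) j := (pt R v - center R d N) ord0 j.
transitivity (\sum_i \sum_j \sum_(v in V d N)
    (w ord0 i * w ord0 j) * (y v i * y v j)).
  under [RHS]eq_bigr do rewrite exchange_big /=.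
  rewrite exchange_big /=; apply: eq_bigr => v _.
  rewrite expr2 /dot big_distrlr /=.
  by apply: eq_bigr => i _; apply: eq_bigr => j _; rewrite /y mulrACA.
rewrite /dot !mulr_sumr; apply: eq_bigr => i _.
rewrite (bigD1 i) //= [X in _ + X]big1 => [|j ji]; last first.
  by rewrite -mulr_sumr sum_V_coord ?mulr0 // eq_sym.
rewrite addr0 -mulr_sumr.
under eq_bigr => v Vv do rewrite -expr2 pt_V_sqr //.
by rewrite sumr_const -[_ *+ _]mulr_natl; ring.
Qed.

Lemma enorm_pt_V_sqr (R : realType) (d N : nat) (v : W d N) : v \in V d N ->
  enorm (pt R v - center R d N) ^+ 2 = d%:R * (N%:R / 2) ^+ 2.
Proof.
move=> Vv; rewrite enorm_sqr /dot.
under eq_bigr => j _ do rewrite -expr2 pt_V_sqr //.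
by rewrite sumr_const card_ord [RHS]mulr_natl.
Qed.

(** Equality holds when [a] is not the center; at the center every cosine is $0$ by the convention
    on division, whence the inequality. *)
Lemma sum_V_cos_sqr_le (R : realType) (d N : nat) (a : 'rV[R]_d) : (0 < N)%N ->
  \sum_(v in V d N) cos (angle a (center R d N) (pt R v)) ^+ 2
    <= #|V d N|%:R / d%:R.
Proof.
move=> N_gt0; set w := a - center R d N.
have N_neq0 : N%:R != 0 :> R by rewrite pnatr_eq0 -lt0n.
(* All vertices are equidistant from the center, so the squared denominator of the cosine is a
   constant that leaves the sum. *)
pose K := dot w w * (d%:R * (N%:R / 2) ^+ 2).
under eq_bigr => v Vv.
  rewrite cos_angle expr_div_n exprMn enorm_pt_V_sqr // enorm_sqr -/w -/K.
  over.
rewrite -mulr_suml sum_V_dot_sqr /K.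
have [->|w_neq0] := eqVneq (dot w w) 0.
  by rewrite !(mulr0, mul0r) divr_ge0.
have [->|d_neq0] := eqVneq (d%:R : R) 0.
  by rewrite !(mulr0, mul0r) invr0 !mulr0.
by rewrite le_eqVlt; apply/predU1P; left; field; rewrite N_neq0 w_neq0 d_neq0.
Qed.

(** Chebyshev's inequality in counting form: each counted [x] contributes at least $t^2$, every
    other one at least $0$. *)
Lemma card_gt_sqr_le (R : realType) (T : finType) (A : {set T}) (f : T -> R)
    (t : R) : 0 <= t ->
  #|[set x in A | t < `|f x|]|%:R * t ^+ 2 <= \sum_(x in A) f x ^+ 2.
Proof.
move=> t_ge0; rewrite mulr_natl -sumr_const.
under eq_bigl do rewrite inE.
rewrite big_mkcondr /=; apply: ler_sum => x _; case: ifP => [tf|_].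
  rewrite -(real_normK (num_real (f x))).
  by apply: lerXn2r; rewrite ?nnegrE // ltW.
exact: sqr_ge0.
Qed.

Theorem theorem4p3 (R : realType) (eta : R) (d : nat) (gamma : R) (N : nat)
    (a : W d N)
    (heta : 0 < eta < 1 / 2)
    (hd : 2 `^ (1 / eta) < d%:R)
    (hgamma : 0 < gamma <= eta - ln 2 / ln d%:R)
    (hN : (1 <= N)%N)
    (ha : d%:R `^ (gamma - eta) <= ndist N (pt R a) (center R d N)) :
  1 - 1 / d%:R `^ (1 - 2 * eta) <=
  1 / #|V d N|%:R *
  #|[set v in V d N |
      `|cos (angle (pt R a) (center R d N) (pt R v))|
        <= (Num.sqrt 2 + 1) * d%:R `^ (- gamma)]|%:R.
Proof.
have d_gt0 : 0 < d%:R :> R by apply: lt_trans hd; rewrite powR_gt0.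
have d_ge1 : 1 <= d%:R :> R by rewrite ler1n -(ltr0n R).
have gamma_le : gamma <= eta.
  case/andP: hgamma => _ /le_trans; apply; rewrite gerBl divr_ge0 //.
    by rewrite ln_ge0 // ler1n.
  exact: ln_ge0.
pose f (v : W d N) := cos (angle (pt R a) (center R d N) (pt R v)).
rewrite -/f; set t := _ * d%:R `^ _; set good := [set v in _ | _].
pose bad := [set v in V d N | t < `|f v|].
(* Here $d \ge 1$, $-\eta \le -\gamma$, and the factor $\sqrt2 + 1$ is at least $1$. *)
have t_ge : d%:R `^ (- eta) <= t.
  apply: (@le_trans _ _ (d%:R `^ (- gamma))); first by rewrite ler_powR ?lerN2.
  by rewrite ler_peMl ?powR_ge0 // lerDr sqrtr_ge0.
have card_split : #|V d N|%:R = #|good|%:R + #|bad|%:R :> R.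
  rewrite -natrD -(cardsID [set v | `|f v| <= t] (V d N)).
  congr (_ + _)%:R; apply: eq_card => v; rewrite !inE // andbC.
  by rewrite ltNge.
pose p : R := d%:R `^ (- eta); have p_gt0 : 0 < p by rewrite powR_gt0.
(* The target exponent is $1/d$ from the mean square combined with $p^{-2}$ from Chebyshev. *)
have dE : d%:R `^ (1 - 2 * eta) = d%:R * p ^+ 2.
  have -> : 1 - 2 * eta = 1 + (- eta - eta) by ring.
  by rewrite !powRD ?(gt_eqF d_gt0) ?implybT // powRr1 ?ltW // expr2.
have V_gt0 : 0 < #|V d N|%:R :> R by rewrite ltr0n card_V_gt0.
(* Chebyshev is applied at [t], then $t^2$ is lowered to $p^2$. *)
have bad_le : #|bad|%:R * p ^+ 2 <= #|V d N|%:R / d%:R.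
  apply: le_trans (sum_V_cos_sqr_le (pt R a) hN).
  apply: le_trans (card_gt_sqr_le _ f (le_trans (ltW p_gt0) t_ge)).
  rewrite ler_wpM2l //; apply: lerXn2r => //; rewrite nnegrE ltW //.
  exact: lt_le_trans t_ge.
have -> : #|good|%:R = #|V d N|%:R - #|bad|%:R :> R by rewrite card_split addrK.
rewrite dE !div1r mulrBr mulVf ?gt_eqF // lerD2l lerN2.
rewrite mulrC ler_pdivrMr // mulrC ler_pdivlMr ?mulr_gt0 ?exprn_gt0 //.
by move: bad_le; rewrite ler_pdivlMr // mulrAC -mulrA.
Qed.
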